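(* Let $n \ge 2$ and let $P$ be an instance of the stable matching problem with $n$ men and $n$ women. Each proposal that is made when running the man-proposing accelerated deferred acceptance (ADA) algorithm on $P$ takes place in a weakly earlier round than it does when running the man-proposing deferred acceptance (DA) algorithm on $P$. That is, for every man $m$, every woman $w$ and every $r \ge 1$: if $m$ proposes to $w$ in round $r$ of ADA, then $m$ proposes to $w$ in some round $r'$ of DA, and $r \le r'$.
   Context: Instance. $M$ is a set of $n$ men and $W$ is a set of $n$ women, $n \ge 2$. An instance $P$ of the stable matching problem consists of, for each man $m \in M$, a strict preference relation (strict linear order) $\succ_m$ on all of $W$, and, for each woman $w \in W$, a strict preference relation (strict linear order) $\succ_w$ on all of $M$. The two (man-proposing) algorithms. Both proceed in rounds $1, 2, 3, \dots$. Initially all men are single, no woman has rejected any man, and no one is matched. Each round has three steps: 1. Each man who is single at the start of the round proposes to his most preferred woman among those who have not yet rejected him. 2. Each woman $w$ who holds at least one proposal tentatively accepts her most preferred proposer $m^*$ (with respect to $\succ_w$). Here the proposers of $w$ in a round are the men who propose to her in that round together with the man, if any, with whom she was tentatively matched at the end of the previous round. Then: - in DA, $w$ rejects all of her proposers that she ranks below $m^*$; - in ADA, $w$ rejects all men in $M$ that she ranks below $m^*$, whether or not they have proposed to her. Rejections are permanent. 3. The man accepted by $w$ is tentatively matched with $w$; every man who is not tentatively matched at the end of the round is single for the next round. The algorithm terminates at the end of the first round after which no man is single, and it returns the current set of tentatively matched pairs. ''$m$ proposes to $w$ in round $r$'' means that $m$ makes this proposal in step 1 of round $r$ (a man who remains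 tentatively matched from a previous round makes no new proposal); in each run a given man proposes to a given woman at most once. *)

(* Defs.v *)
From mathcomp Require Import all_boot.
Set Implicit Arguments.
Unset Strict Implicit.
Unset Printing Implicit Defensive.

Definition strict_linear_order (T : Type) (r : rel T) : Prop :=
  [/\ irreflexive r, transitive r & forall x y, x <> y -> r x y || r y x].

(* [man_pref P m w w'] reads w >_m w' (m prefers w to w'); likewise for
   [woman_pref]. *)
Record instance (M W : finType) := Instance {
  man_pref : M -> rel W;
  woman_pref : W -> rel M;
  man_pref_slo : forall m, strict_linear_order (man_pref m);
  woman_pref_slo : forall w, strict_linear_order (woman_pref w) }.

Definition most_preferred (T : finType) (pref : rel T) (A : {set T}) (x : T) :=
  (x \in A) && [forall y in A, (y != x) ==> pref x y].

Inductive algorithm := DA | ADA.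

(* [(m, w) \in rejected s] means that w has rejected m. *)
Record state (M W : finType) := State {
  matched : {set M * W};
  rejected : {set M * W} }.

Definition initial_state (M W : finType) : state M W := State set0 set0.

Section Round.
Variables (M W : finType) (P : instance M W).
Implicit Types (s : state M W) (m : M) (w : W).

Definition single s m := [forall w, (m, w) \notin matched s].

Definition not_rejected_by s m : {set W} := [set w | (m, w) \notin rejected s].

Definition proposes s m w :=
  single s m && most_preferred (man_pref P m) (not_rejected_by s m) w.

Definition proposers s w : {set M} :=
  [set m | proposes s m w || ((m, w) \in matched s)].

Definition accepts s w m := most_preferred (woman_pref P w) (proposers s w) m.

Definition rejects (alg : algorithm) s w m :=
  [exists m_best, [&& accepts s w m_best, woman_pref P w m_best m &
     match alg with DA => m \in proposers s w | ADA => true end]].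

Definition round (alg : algorithm) s : state M W :=
  State [set mw | accepts s mw.2 mw.1]
        (rejected s :|: [set mw | rejects alg s mw.2 mw.1]).

(* Termination needs no separate flag: only single men propose, so once no man
   is single no further round contains a proposal or changes the matching. *)
Definition state_after (alg : algorithm) (r : nat) : state M W :=
  iter r (round alg) (initial_state M W).

(* Rounds are numbered from 1, so round r starts from the state after round
   r - 1; there is no round 0. *)
Definition proposes_in_round (alg : algorithm) (r : nat) m w : bool :=
  (0 < r) && proposes (state_after alg r.-1) m w.

End Round.

(* Main.v *)
(** In both algorithms every man always targets his favourite among the women
    who have not rejected him (proposing to her if he is single, being held by
    her otherwise), and a woman who has rejected a man holds someone she
    prefers to him.  Hence:
    - After each round, whoever was rejected in DA was rejected in ADA: if [w]
      rejects [m] in DA in favour of [m'], then in ADA [m'] is targeting [w] or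
      was rejected by her, so that [w] holds there someone at least as good as
      [m'].  A man who has come down to [w] in DA has thus come down to [w], or
      below, by the same round of ADA.
    - If [w] ever rejects [m] in ADA, then once DA has stabilised [w] holds
      someone she prefers to [m].  So the man [m] who proposes to [w] in ADA
      cannot end up in DA with a woman above [w], and must have proposed
      to [w]. *)

Require Import Defs.
From mathcomp Require Import all_boot.
Set Implicit Arguments.
Unset Strict Implicit.
Unset Printing Implicit Defensive.

(** * Maxima of a strict linear order on a finite set *)

Section MostPreferred.
Variables (T : finType) (pref : rel T).
Implicit Types (A B : {set T}) (x y : T).

Lemma most_preferred_mem A x : most_preferred pref A x -> x \in A.
Proof. by case/andP. Qed.

Lemma most_preferred_lt A x y :
  most_preferred pref A x -> y \in A -> y != x -> pref x y.
Proof. by case/andP=> _ /forall_inP h yA; apply/implyP/h. Qed.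

Lemma most_preferred_sub A B x :
  B \subset A -> x \in B -> most_preferred pref A x -> most_preferred pref B x.
Proof.
move=> /subsetP sBA xB xtop; apply/andP; split=> //.
apply/forall_inP=> y /sBA yA; apply/implyP; exact: most_preferred_lt xtop yA.
Qed.

Hypothesis pref_slo : strict_linear_order pref.

Lemma most_preferred_uniq A x y :
  most_preferred pref A x -> most_preferred pref A y -> x = y.
Proof.
have [irr tr _] := pref_slo => xtop ytop; apply/eqP/contraT => neq_xy.
have yx := most_preferred_lt ytop (most_preferred_mem xtop) neq_xy.
rewrite eq_sym in neq_xy.
have xy := most_preferred_lt xtop (most_preferred_mem ytop) neq_xy.
by have := tr _ _ _ xy yx; rewrite irr.
Qed.

Lemma most_preferred_exists A y :
  y \in A -> exists x, most_preferred pref A x.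
Proof.
have [irr tr tot] := pref_slo => yA.
(* The maximum is the element ranked above the most others: if [z] beat [x], then [z] would beat [x]
   itself and all that [x] beats. *)
case: (@arg_maxnP _ y (mem A) (fun x => #|[set z | pref x z]|) yA) => x xA xmax.
exists x; apply/andP; split=> //; apply/forall_inP=> z zA; apply/implyP=> neq_zx.
have /orP[//|zx] : pref x z || pref z x.
  by apply: tot => eq_xz; rewrite eq_xz eqxx in neq_zx.
have := xmax z zA; rewrite /= leqNgt proper_card //; apply/properP; split.
  by apply/subsetP=> t; rewrite !inE; apply: tr zx.
by exists x; rewrite inE ?irr.
Qed.

Lemma most_preferred_trans A x y z :
  most_preferred pref A x -> y \in A -> pref y z -> pref x z.
Proof.
have [_ tr _] := pref_slo => xtop yA yz; have [<-//|neq_yx] := eqVneq y x.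
exact: tr (most_preferred_lt xtop yA neq_yx) yz.
Qed.

End MostPreferred.

(** * Invariants of a run *)

Section Runs.
Variables (M W : finType) (P : instance M W).
Implicit Types (alg : algorithm) (s : state M W) (m : M) (w : W).

(** [proposes] without the [single] test, so that held men are covered too. *)
Definition targets s m w :=
  most_preferred (man_pref P m) (not_rejected_by s m) w.

Lemma targets_not_rejected s m w : targets s m w -> (m, w) \notin rejected s.
Proof. by move/most_preferred_mem; rewrite inE. Qed.

Lemma targets_uniq s m w w' : targets s m w -> targets s m w' -> w = w'.
Proof. exact: most_preferred_uniq (man_pref_slo P m) _ _ _. Qed.

Lemma targets_mono s s' m w :
  rejected s \subset rejected s' -> (m, w) \notin rejected s' ->
  targets s m w -> targets s' m w.
Proof.
move=> /subsetP sub nrej; apply: most_preferred_sub; last by rewrite inE.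
by apply/subsetP=> w'; rewrite !inE; apply/contra/sub.
Qed.

Definition coherent s :=
  (forall m w, (m, w) \in matched s -> targets s m w) /\
  (forall m w, (m, w) \in rejected s ->
     exists2 m', (m', w) \in matched s & woman_pref P w m' m).

(** Makes the proposers a function of the rejections alone: a man who is not single is held by his
    unique target. *)
Lemma mem_proposers s m w :
  coherent s -> (m \in proposers P s w) = targets s m w.
Proof.
case=> matched_targets _; rewrite inE /proposes; apply/idP/idP.
  by case/orP => [/andP[]//|]; apply: matched_targets.
move=> tgt; rewrite -/(targets s m w) tgt andbT.
case: (boolP (single s m)) => //=; rewrite negb_forall => /existsP[w'].
rewrite negbK => mat; rewrite (targets_uniq tgt (matched_targets _ _ mat)).
exact: mat.
Qed.

Lemma matched_proposers s m w :
  (m, w) \in matched s -> m \in proposers P s w.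
Proof. by rewrite inE orbC => ->. Qed.

Lemma accepts_trans s w m m1 m2 :
  accepts P s w m -> m1 \in proposers P s w -> woman_pref P w m1 m2 ->
  woman_pref P w m m2.
Proof. exact: most_preferred_trans (woman_pref_slo P w) _ _ _ _. Qed.

Lemma accepts_exists s w m :
  m \in proposers P s w -> exists m', accepts P s w m'.
Proof. exact: most_preferred_exists (woman_pref_slo P w) _ _. Qed.

Lemma rejected_round alg s : rejected s \subset rejected (round P alg s).
Proof. exact: subsetUl. Qed.

Lemma round_matched_or_rejected alg s m w :
  m \in proposers P s w -> (m, w) \notin rejected (round P alg s) ->
  (m, w) \in matched (round P alg s).
Proof.
move=> prop; rewrite !inE negb_or => /andP[_ /=]; apply: contraR => nacc.
have [m' acc] := accepts_exists prop.
apply/existsP; exists m'; rewrite acc prop /=; apply/andP; split; last by case: alg.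
apply: (most_preferred_lt acc prop); apply: contraNneq nacc => ->; exact: acc.
Qed.

(** The man held by a woman is again among her proposers, so what she holds only improves and stays
    above everyone she has rejected. *)
Lemma coherent_round alg s : coherent s -> coherent (round P alg s).
Proof.
move=> coh; have [_ rejected_held] := coh; split=> m w.
  rewrite inE /= => acc.
  have tgt : targets s m w by rewrite -mem_proposers ?(most_preferred_mem acc).
  apply: (targets_mono (rejected_round alg s) _ tgt).
  rewrite inE negb_or (targets_not_rejected tgt) inE /=.
  apply/existsP=> -[m' /and3P[acc' lt _]].
  have [irr _ _] := woman_pref_slo P w.
  by rewrite (most_preferred_uniq (woman_pref_slo P w) acc' acc) irr in lt.
rewrite !inE /= => /orP[/rejected_held[m1 /matched_proposers prop lt]|].
  have [m' acc] := accepts_exists prop.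
  by exists m'; rewrite ?inE //; apply: accepts_trans acc prop lt.
by case/existsP=> m' /and3P[acc lt _]; exists m'; rewrite ?inE.
Qed.

Lemma coherent_state_after alg r : coherent (state_after P alg r).
Proof.
elim: r => [|r IHr]; last exact: coherent_round.
by split=> m w; rewrite inE.
Qed.

Lemma rejected_state_after alg r r' : r <= r' ->
  rejected (state_after P alg r) \subset rejected (state_after P alg r').
Proof.
move/subnK<-; elim: (r' - r) => [|k IHk]; first exact: subxx.
exact: subset_trans IHk (rejected_round _ _).
Qed.

Lemma proposes_in_round_of_targets alg t m w :
  targets (state_after P alg t) m w ->
  exists r, proposes_in_round P alg r m w.
Proof.
rewrite -mem_proposers; last exact: coherent_state_after.
elim: t => [|t IHt]; rewrite inE => /orP[prop|].
- by exists 1.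
- by rewrite inE.
(* Round [t.+2] starts from the state after [t.+1] rounds. *)
- by exists t.+2.
- by rewrite inE => /most_preferred_mem; apply: IHt.
Qed.

(** Specific to DA, where only proposers get rejected. *)
Lemma targets_of_rejected_DA t m w :
  (m, w) \in rejected (state_after P DA t) ->
  exists t', targets (state_after P DA t') m w.
Proof.
elim: t => [|t IHt]; first by rewrite inE.
rewrite inE => /orP[/IHt//|]; rewrite inE => /existsP[m' /and3P[_ _ prop]].
by exists t; rewrite -mem_proposers //; apply: coherent_state_after.
Qed.

Lemma rejected_DA_sub_ADA r :
  rejected (state_after P DA r) \subset rejected (state_after P ADA r).
Proof.
elim: r => [|r IHr]; first exact: subxx.
have cohD := coherent_state_after DA r; have cohA := coherent_state_after ADA r.
rewrite subUset (subset_trans IHr (rejected_round _ _)) /=.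
apply/subsetP=> -[m w]; rewrite inE => /existsP[m1 /= /and3P[acc1 lt1 _]].
(* [m2] is [m1] if he still targets [w] in ADA, and otherwise the man whom [w] holds there after
   rejecting [m1]. *)
have [m2 prop2 lt2] : exists2 m2,
    m2 \in proposers P (state_after P ADA r) w & woman_pref P w m2 m.
  have [rej1|nrej1] := boolP ((m1, w) \in rejected (state_after P ADA r)).
    have [m2 /matched_proposers prop2 lt2] := cohA.2 _ _ rej1.
    have [_ tr _] := woman_pref_slo P w.
    by exists m2 => //; apply: tr lt1.
  exists m1 => //; rewrite mem_proposers //; apply: targets_mono IHr nrej1 _.
  by rewrite -mem_proposers ?(most_preferred_mem acc1).
have [m3 acc3] := accepts_exists prop2.
rewrite !inE; apply/orP; right; apply/existsP; exists m3.
by rewrite acc3 /= (accepts_trans acc3 prop2 lt2).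
Qed.

Lemma rejected_stabilises alg : exists t,
  rejected (state_after P alg t.+1) = rejected (state_after P alg t).
Proof.
(* Until the rejections stabilise, each round adds at least one, and there are at most [#|M * W|] of
   them. *)
have large k : (exists t,
    rejected (state_after P alg t.+1) = rejected (state_after P alg t)) \/
    k <= #|rejected (state_after P alg k)|.
  elim: k => [|k [|IHk]]; [by right|by left|].
  have [eq_rej|neq] := eqVneq (rejected (state_after P alg k.+1))
    (rejected (state_after P alg k)); first by left; exists k.
  right; apply: leq_ltn_trans IHk (proper_card _).
  by rewrite properEneq eq_sym neq rejected_round.
have [//|] := large #|{: M * W}|.+1.
by rewrite ltnNge max_card.
Qed.

(** * Comparing ADA with a stabilised run of DA *)

Section StableDA.
Variable t : nat.
Hypothesis stable_t :
  rejected (state_after P DA t.+1) = rejected (state_after P DA t).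

(** Otherwise both men would be proposers of [w], and the next round would add a rejection of
    [m]. *)
Lemma stable_targets_best m m' w :
  targets (state_after P DA t) m w -> targets (state_after P DA t) m' w ->
  ~~ woman_pref P w m' m.
Proof.
have coh := coherent_state_after DA t => tgt tgt'.
have := targets_not_rejected tgt; rewrite -stable_t; apply: contra => lt.
have prop : m \in proposers P (state_after P DA t) w by rewrite mem_proposers.
have prop' : m' \in proposers P (state_after P DA t) w by rewrite mem_proposers.
have [m2 acc] := accepts_exists prop'.
rewrite !inE; apply/orP; right; apply/existsP; exists m2.
by rewrite acc prop (accepts_trans acc prop' lt).
Qed.

Lemma rejected_ADA_stable_DA r :
  (forall m w, (m, w) \in rejected (state_after P ADA r) ->
    exists2 m', targets (state_after P DA t) m' w & woman_pref P w m' m) /\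
  (forall m w, targets (state_after P ADA r) m w ->
    targets (state_after P DA t) m w \/
    (m, w) \in rejected (state_after P DA t)).
Proof.
have [cohD rejD] := coherent_state_after DA t.
(* At each round the claim on targets follows from the claim on rejections; the induction on the
   latter uses it for the man whom [w] accepts. *)
have targets_case k :
    (forall m w, (m, w) \in rejected (state_after P ADA k) ->
      exists2 m', targets (state_after P DA t) m' w & woman_pref P w m' m) ->
    forall m w, targets (state_after P ADA k) m w ->
    targets (state_after P DA t) m w \/
    (m, w) \in rejected (state_after P DA t).
  move=> rejA m w tgtA.
  have [|nrej] := boolP ((m, w) \in rejected (state_after P DA t)); first by right.
  left; have wD : w \in not_rejected_by (state_after P DA t) m by rewrite inE.
  have [w' tgtD] := most_preferred_exists (man_pref_slo P m) wD.
  have [<-//|neq_w] := eqVneq w' w.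
  have [irr tr _] := man_pref_slo P m.
  have lt : man_pref P m w' w.
    by apply: (most_preferred_lt tgtD wD); rewrite eq_sym.
  (* Since [m] targets [w] in ADA, the better [w'] has rejected him there. *)
  have [m' tgt' lt'] : exists2 m',
      targets (state_after P DA t) m' w' & woman_pref P w' m' m.
    apply: rejA; apply/contraT => nrejA.
    have w'A : w' \in not_rejected_by (state_after P ADA k) m by rewrite inE.
    have gt := most_preferred_lt tgtA w'A neq_w.
    by have := tr _ _ _ lt gt; rewrite irr.
  by have := stable_targets_best tgtD tgt'; rewrite lt'.
suff rejA : forall m w, (m, w) \in rejected (state_after P ADA r) ->
    exists2 m', targets (state_after P DA t) m' w & woman_pref P w m' m.
  by split=> //; apply: targets_case.
elim: r => [|r IHr] m w; first by rewrite inE.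
rewrite inE => /orP[/IHr//|]; rewrite inE => /existsP[m1 /= /and3P[acc lt _]].
have tgt1 : targets (state_after P ADA r) m1 w.
  rewrite -mem_proposers ?(most_preferred_mem acc) //.
  exact: coherent_state_after.
have [tgt|rej] := targets_case r IHr _ _ tgt1; first by exists m1.
have [m' mat lt'] := rejD _ _ rej; exists m'; first exact: cohD.
by have [_ tr _] := woman_pref_slo P w; apply: tr lt.
Qed.

End StableDA.

Lemma proposes_ADA_proposes_DA r m w :
  proposes_in_round P ADA r m w -> exists r', proposes_in_round P DA r' m w.
Proof.
case/and3P=> _ _ tgt; have [t stable_t] := rejected_stabilises DA.
have [_ /(_ m w tgt)[|/targets_of_rejected_DA[t']]] :=
  rejected_ADA_stable_DA stable_t r.-1; exact: proposes_in_round_of_targets.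
Qed.

(** If [r'] were smaller, [m] would already target [w] in the ADA round before [r]; not being
    rejected then, he would be held by [w] and not be single in round [r]. *)
Lemma proposes_ADA_leq_DA r r' m w :
  proposes_in_round P ADA r m w -> proposes_in_round P DA r' m w -> r <= r'.
Proof.
case/and3P=> _ sgl tgtA /and3P[r'_gt0 _ tgtD]; rewrite leqNgt.
apply/negP=> lt_r'r; case: r => [|[|r]] in sgl tgtA lt_r'r *; first by [].
  by case: (r') r'_gt0 lt_r'r.
(* The ADA round is now [r.+2], and the state after [r] rounds is the start of the round before
   it. *)
rewrite /= in sgl tgtA; have nrej := targets_not_rejected tgtA.
have le_r'r : r'.-1 <= r by case: (r') r'_gt0 lt_r'r.
have sub := subset_trans (rejected_DA_sub_ADA r'.-1)
              (rejected_state_after ADA le_r'r).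
have nrej' : (m, w) \notin rejected (state_after P ADA r).
  by apply: contra nrej; apply/subsetP/rejected_round.
have tgt := targets_mono sub nrej' tgtD.
have prop : m \in proposers P (state_after P ADA r) w.
  by rewrite mem_proposers //; apply: coherent_state_after.
by move/forallP/(_ w): sgl; rewrite (round_matched_or_rejected prop nrej).
Qed.

End Runs.

Theorem theorem5 (n : nat) (M W : finType) (P : instance M W)
    (n_ge2 : 2 <= n) (card_men : #|M| = n) (card_women : #|W| = n)
    (m : M) (w : W) (r : nat) (r_ge1 : 1 <= r) :
  proposes_in_round P ADA r m w ->
  exists r' : nat, proposes_in_round P DA r' m w /\ r <= r'.
Proof.
move=> propA; have [r' propD] := proposes_ADA_proposes_DA propA.
by exists r'; split=> //; apply: proposes_ADA_leq_DA propA propD.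
Qed.
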